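(* Let $n\ge 1$ be an integer and $\Omega\ge 1$ a real number. Fix $u>0$. Every maximizer of $q(u;\mathbf{r})$ (as a function of $\mathbf{r}$) on $\mathcal{B}=[\Omega^{-1},\Omega]^n$ lies either at a vertex or on a one-dimensional face (edge) of $\mathcal{B}$. By the reversal symmetry $q(u;\mathbf{r})=q(u^{-1};\mathbf{r}^{-1})$, where $\mathbf{r}^{-1}=(r_n^{-1},r_{n-1}^{-1},\dots,r_1^{-1})$, it suffices to examine edges with free coordinate $r_k$ for $k=1,2,\dots,\lceil n/2\rceil$.
   Context: For an integer $n\ge 1$, a real $u>0$ and a vector $\mathbf{r}=(r_1,\dots,r_n)$ of positive reals, define $$a_i(u;\mathbf{r})=\binom{n}{i}\Bigl(\prod_{j=1}^{i}r_j\Bigr)u^{i}\quad(0\le i\le n),\qquad p_i=\frac{a_i(u;\mathbf{r})}{\sum_{j=0}^{n}a_j(u;\mathbf{r})},\qquad \bar\mu=\sum_{j=0}^{n}j\,p_j,$$ where the empty product equals $1$, and $$q(u;\mathbf{r})=\frac{(1+u)^2}{n\,u}\sum_{i=0}^{n}(i-\bar\mu)^2p_i.$$ A vertex of $\mathcal{B}$ is a point with every coordinate in $\{\Omega^{-1},\Omega\}$. An edge of $\mathcal{B}$ with free coordinate $r_k$ is a set of all $\mathbf{r}$ with $r_k\in[\Omega^{-1},\Omega]$ arbitrary and each other coordinate $r_j$ ($j\ne k$) frozen at a value in $\{\Omega^{-1},\Omega\}$. The reversal symmetry $q(u;\mathbf{r})=q(u^{-1};\mathbf{r}^{-1})$ holds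 for all $u>0$ and all positive ratio vectors $\mathbf{r}$. *)

(* Defs.v *)
From HB Require Import structures.
From mathcomp Require Import all_boot all_order all_algebra.
From mathcomp Require Import all_classical all_reals.
Set Implicit Arguments.
Unset Strict Implicit.
Unset Printing Implicit Defensive.
Import Order.TTheory GRing.Theory Num.Theory.
Local Open Scope classical_set_scope.
Local Open Scope ring_scope.

(* The ratio vector (r_1, ..., r_n) is [r : 'rV[R]_n], with r_(j+1) = r 0 j
   since ordinals start at 0; so r_1 ... r_i is the product of the entries of
   index smaller than i. *)
Definition weight (R : realType) (n : nat) (u : R) (r : 'rV[R]_n) (i : nat) : R :=
  'C(n, i)%:R * (\prod_(j < n | (j < i)%N) r 0 j) * u ^+ i.

Definition prob (R : realType) (n : nat) (u : R) (r : 'rV[R]_n) (i : nat) : R :=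
  weight u r i / \sum_(j < n.+1) weight u r j.

Definition mean (R : realType) (n : nat) (u : R) (r : 'rV[R]_n) : R :=
  \sum_(j < n.+1) j%:R * prob u r j.

Definition q (R : realType) (n : nat) (u : R) (r : 'rV[R]_n) : R :=
  (1 + u) ^+ 2 / (n%:R * u) *
  \sum_(i < n.+1) (i%:R - mean u r) ^+ 2 * prob u r i.

Definition box (R : realType) (n : nat) (Omega : R) : set 'rV[R]_n :=
  [set r | forall j, Omega^-1 <= r 0 j <= Omega].

Definition vertex (R : realType) (n : nat) (Omega : R) (r : 'rV[R]_n) : Prop :=
  forall j, r 0 j = Omega^-1 \/ r 0 j = Omega.

(* [E] is an edge whose free coordinate is that of index [k]; the entry
   [c 0 k] of the vector of frozen values is irrelevant. *)
Definition edge (R : realType) (n : nat) (Omega : R) (k : 'I_n)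
    (E : set 'rV[R]_n) : Prop :=
  exists2 c : 'rV[R]_n,
    (forall j, j != k -> c 0 j = Omega^-1 \/ c 0 j = Omega) &
    E = [set r | Omega^-1 <= r 0 k <= Omega /\
                 forall j, j != k -> r 0 j = c 0 j].

Definition maximizer (R : realType) (T : Type) (f : T -> R) (A : set T) (x : T)
    : Prop :=
  A x /\ forall y, A y -> f y <= f x.

(* (r_1, ..., r_n) |-> (r_n^-1, ..., r_1^-1) *)
Definition revinv (R : realType) (n : nat) (r : 'rV[R]_n) : 'rV[R]_n :=
  \row_j (r 0 (rev_ord j))^-1.

(* Main.v *)
(* Multiplying r_k by 1 + s multiplies the weights a_i with i >= k by 1 + s, so
   the derivative of the variance V in log r_k is F_k, the sum over i >= k of
   p_i h_i with h_i = (i - mu)^2 - V. If a maximizer had two coordinates r_k, r_l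
   strictly inside [1/Omega, Omega], then F_k = F_l = 0; as p_i h_i also sums to 0
   over all i, it sums to 0 on each of the three blocks cut out by k and l, which
   is incompatible with the strict convexity of h. The bound on q over the box
   reduces to edges because q is continuous and so attains its maximum. *)
Require Import Defs.
From HB Require Import structures.
From mathcomp Require Import all_boot all_order all_algebra.
From mathcomp Require Import all_classical all_reals.
From mathcomp Require Import topology normedtype derive.
From mathcomp Require Import ring lra zify.
Set Implicit Arguments.
Unset Strict Implicit.
Unset Printing Implicit Defensive.
Import Order.TTheory GRing.Theory Num.Theory numFieldNormedType.Exports.
Local Open Scope classical_set_scope.
Local Open Scope ring_scope.

(** * Variance of a finite weighted family and its change under tilting *)

Section WeightedVariance.
Variables (R : realType) (m : nat) (x : 'I_m -> R).
Implicit Types (w : 'I_m -> R) (A : pred 'I_m).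

(** The weights stay unnormalized, so that tilting some of them leaves the others untouched. *)
Definition wmean w := (\sum_i x i * w i) / \sum_i w i.

Definition wvar w := (\sum_i (x i - wmean w) ^+ 2 * w i) / \sum_i w i.

Lemma wvar_shift w c : \sum_i w i != 0 ->
  wvar w = (\sum_i (x i - c) ^+ 2 * w i) / (\sum_i w i)
           - ((\sum_i (x i - c) * w i) / \sum_i w i) ^+ 2.
Proof.
have sq d : \sum_i (x i - d) ^+ 2 * w i = \sum_i x i ^+ 2 * w i
    - 2 * d * (\sum_i x i * w i) + d ^+ 2 * \sum_i w i.
  rewrite !mulr_sumr -sumrB -big_split /=; apply: eq_bigr => i _; ring.
have li : \sum_i (x i - c) * w i = \sum_i x i * w i - c * \sum_i w i.
  rewrite mulr_sumr -sumrB; apply: eq_bigr => i _; ring.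
rewrite /wvar /wmean !sq li => S0; by field.
Qed.

(* The increment [s] times this number is the first-order variation of the
   variance when the weights in [A] are multiplied by [1 + s]. *)
Definition dvar w A := \sum_(i | A i) ((x i - wmean w) ^+ 2 - wvar w) * w i.

Lemma dvar_predT w : \sum_i w i != 0 -> dvar w predT = 0.
Proof.
move=> S0; rewrite /dvar; under eq_bigr do rewrite mulrBl.
by rewrite sumrB -mulr_sumr /wvar divfK// subrr.
Qed.

(** By [wvar_shift] about the old mean: the second moment yields the [dvar] term, and the subtracted
    square is the squared displacement of the mean. The identity is exact in [s]. *)
Lemma wvar_tilt w A s (w' := fun i => (1 + s * (A i)%:R) * w i) :
  \sum_i w i != 0 -> \sum_i w' i != 0 ->
  wvar w' - wvar w = s * dvar w A / (\sum_i w' i)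
    - (s * (\sum_(i | A i) (x i - wmean w) * w i) / \sum_i w' i) ^+ 2.
Proof.
move=> S0 S'0.
have split f : \sum_i f i * w' i =
    \sum_i f i * w i + s * \sum_(i | A i) f i * w i.
  rewrite mulr_sumr [in X in _ + X]big_mkcond -big_split /=.
  by apply: eq_bigr => i _; rewrite /w'; case: (A i) => /=; ring.
have center : \sum_i (x i - wmean w) * w i = 0.
  under eq_bigr do rewrite mulrBl.
  by rewrite sumrB -mulr_sumr /wmean divfK// subrr.
rewrite (wvar_shift (wmean w) S'0) [X in (X / _) ^+ 2]split center add0r.
have -> : \sum_i (x i - wmean w) ^+ 2 * w' i =
    s * dvar w A + wvar w * \sum_i w' i.
  have := split (fun i => (x i - wmean w) ^+ 2 - wvar w).
  rewrite -/(dvar w predT) -/(dvar w A) dvar_predT// add0r => <-.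
  rewrite mulr_sumr -big_split /=; apply: eq_bigr => i _; ring.
by field.
Qed.

(** Fermat's rule: if [dvar w A] were nonzero, its term in [wvar_tilt] would outweigh the square for
    a small [s] of the same sign. *)
Lemma dvar_eq0 w A (d : R) : 0 < d -> 0 < \sum_i w i ->
  (forall s, `|s| < d -> let w' := fun i => (1 + s * (A i)%:R) * w i in
     0 < \sum_i w' i /\ wvar w' <= wvar w) ->
  dvar w A = 0.
Proof.
move=> d0 S0 H; apply/eqP/negPn/negP => F0.
set F := dvar w A in F0 *.
set B := \sum_(i | A i) (x i - wmean w) * w i.
set S := \sum_i w i in S0.
set W := \sum_(i | A i) w i.
pose C := `|B ^+ 2 - F * W| + 1.
have C0 : 0 < C by rewrite /C ltr_wpDl.
have aF0 : 0 < `|F| by rewrite normr_gt0.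
(* The first bound gives [|s| < d]; the second gives [e * C < |F| * S], where [C] exceeds the
   quadratic coefficient [B ^+ 2 - F * W]. *)
pose e := Num.min (d / 2) (`|F| * S / (2 * C)).
have e0 : 0 < e by rewrite lt_min !divr_gt0 ?mulr_gt0.
pose s := Num.sg F * e.
have sE : `|s| = e by rewrite normrM normr_sg F0 mul1r gtr0_norm.
have sd : `|s| < d.
  have : e <= d / 2 by rewrite ge_min lexx.
  by rewrite sE => /le_lt_trans-> //; rewrite ltr_pdivrMr// ltr_pMr// ltr1n.
have [/= S'0] := H s sd.
set S' := \sum_i _ in S'0 *.
rewrite -subr_le0 wvar_tilt ?gt_eqF// -/S' -/F -/B.
have S'E : S' = S + s * W.
  rewrite /S' /S /W mulr_sumr [in X in _ + X]big_mkcond -big_split /=.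
  by apply: eq_bigr => i _; case: (A i) => /=; ring.
have -> : s * F / S' - (s * B / S') ^+ 2 =
   (s * F * S - s ^+ 2 * (B ^+ 2 - F * W)) / S' ^+ 2.
  by rewrite S'E; field; rewrite -S'E gt_eqF.
rewrite pmulr_lle0 ?invr_gt0 ?exprn_gt0// subr_le0; apply/negP; rewrite -ltNge.
have sF : s * F = e * `|F| by rewrite /s mulrAC -normrEsg mulrC.
have s2 : s ^+ 2 = e ^+ 2 by rewrite -sE real_normK// num_real.
rewrite sF s2 expr2 -!mulrA ltr_pM2l//.
have : e * C < `|F| * S.
  have : e <= `|F| * S / (2 * C) by rewrite ge_min lexx orbT.
  rewrite ler_pdivlMr ?mulr_gt0// => h.
  have : 0 < e * C by rewrite mulr_gt0.
  lra.
apply: le_lt_trans; rewrite ler_pM2l//.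
by rewrite (le_trans (ler_norm _))// lerDl.
Qed.

Lemma wvar_scale w a : a != 0 -> wvar (fun i => a * w i) = wvar w.
Proof.
move=> a0; have sumZ f : \sum_i f i * (a * w i) = a * \sum_i f i * w i.
  by rewrite mulr_sumr; apply: eq_bigr => i _; rewrite mulrCA.
have cancel b : (a * b) / (\sum_i a * w i) = b / \sum_i w i.
  by rewrite -mulr_sumr invfM mulrACA divff ?mul1r.
by rewrite /wvar /wmean !sumZ !cancel.
Qed.

Lemma eq_wvar w1 w2 : w1 =1 w2 -> wvar w1 = wvar w2.
Proof. by move=> /funext ->. Qed.

(** A positive [f] on [A] would give a positive sum; [i0] rules out the empty sum. *)
Lemma exists_nonpos_of_sum w A i0 (f : 'I_m -> R) : (forall i, 0 < w i) -> A i0 ->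
  \sum_(i | A i) f i * w i <= 0 -> exists2 i, A i & f i <= 0.
Proof.
move=> w0 Ai0 /le_gtF sum0; apply/exists2P; apply: contrapT => /forallNP no.
move/negP: sum0; apply.
have f0 i : A i -> 0 < f i.
  by move=> Ai; rewrite ltNge; apply/negP => fi; apply: (no i).
rewrite (bigD1 i0)//= ltr_pwDl ?mulr_gt0 ?f0//.
by apply: sumr_ge0 => i /andP[Ai _]; rewrite ltW ?mulr_gt0 ?f0.
Qed.

End WeightedVariance.

(** * Reflection and convexity on the points 0, ..., n *)

Lemma wvar_rev (R : realType) (n : nat) (w : 'I_n.+1 -> R) :
  \sum_i w i != 0 ->
  wvar (fun i => i%:R) (fun i => w (rev_ord i)) = wvar (fun i => i%:R) w.
Proof.
move=> S0; rewrite /wvar.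
have revE (i : 'I_n.+1) : (rev_ord i)%:R = n%:R - i%:R :> R.
  by rewrite /= subSS natrB// leq_ord.
have sum_rev : \sum_i w (rev_ord i) = \sum_i w i.
  by rewrite [RHS](reindex_inj rev_ord_inj).
have mean_rev : wmean (fun i => i%:R) (fun i => w (rev_ord i)) =
    n%:R - wmean (fun i => i%:R) w.
  apply: (mulIf S0); rewrite /wmean sum_rev divfK// mulrBl divfK//.
  rewrite (reindex_inj rev_ord_inj) mulr_sumr -sumrB; apply: eq_bigr => i _.
  by rewrite rev_ordK revE mulrBl.
rewrite sum_rev mean_rev; congr (_ / _).
rewrite (reindex_inj rev_ord_inj); apply: eq_bigr => i _.
by rewrite rev_ordK revE; congr (_ * _); ring.
Qed.

(* Otherwise [h i = (i - mean)^2 - variance] has weighted sum zero on each of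
   [0, k], (k, l] and (l, n], so [h x <= 0 <= h y] and [h z <= 0] for some
   [x < y < z]. *)
Lemma dvar_tail_inj (R : realType) (n : nat) (w : 'I_n.+1 -> R) (k l : nat) :
  (forall i, 0 < w i) -> (k < l)%N -> (l < n)%N ->
  dvar (fun i => i%:R) w [pred i : 'I_n.+1 | (k < i)%N] = 0 ->
  dvar (fun i => i%:R) w [pred i : 'I_n.+1 | (l < i)%N] != 0.
Proof.
move=> w0 kl ln Fk; apply/eqP => Fl.
have S0 : \sum_i w i != 0.
  by rewrite gt_eqF// (bigD1 ord0)//= ltr_pwDl ?sumr_ge0// => i _; rewrite ltW.
have := dvar_predT (fun i => i%:R) S0.
move: Fk Fl; rewrite /dvar; set c := wmean _ _; set V := wvar _ _ => /= Fk Fl F0.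
pose h (i : 'I_n.+1) : R := (i%:R - c) ^+ 2 - V.
have [x xk hx] : exists2 x : 'I_n.+1, ~~ (k < x)%N & h x <= 0.
  apply: (@exists_nonpos_of_sum _ _ w [pred i : 'I_n.+1 | ~~ (k < i)%N] ord0) => //=.
  by move: F0; rewrite (bigID [pred i : 'I_n.+1 | (k < i)%N]) /= Fk add0r => ->.
have [z lz hz] : exists2 z : 'I_n.+1, (l < z)%N & h z <= 0.
  by apply: (@exists_nonpos_of_sum _ _ w [pred i : 'I_n.+1 | (l < i)%N] ord_max) => //=; rewrite Fl.
have [y /andP[ky yl] hy] :
    exists2 y : 'I_n.+1, (k < y)%N && ~~ (l < y)%N & - h y <= 0.
  apply: (@exists_nonpos_of_sum _ _ w [pred i : 'I_n.+1 | (k < i)%N && ~~ (l < i)%N] (inord l)).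
  - by [].
  - by rewrite /= inordK ?kl ?ltnn// ltnS ltnW.
  under eq_bigr do rewrite mulNr.
  (* As k < l, the tail past [k] is the middle block plus the tail past [l], and both tails sum to
     0. *)
  rewrite sumrN oppr_le0 -[X in X <= _]Fk (bigID [pred i : 'I_n.+1 | (l < i)%N]).
  rewrite /= -[X in _ <= X]add0r lerD2r -[X in _ <= X]Fl le_eqVlt; apply/orP; left.
  apply/eqP/eq_bigl => i /=.
  by case: (ltnP l i) => [/(ltn_trans kl) ->|_]; rewrite ?andbF.
have xy : (x : nat)%:R < (y : nat)%:R :> R.
  by rewrite ltr_nat; rewrite -leqNgt in xk; lia.
have yz : (y : nat)%:R < (z : nat)%:R :> R.
  by rewrite ltr_nat; rewrite -leqNgt in yl; lia.
move: hx hy hz xy yz; rewrite /h.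
move: (x%:R : R) (y%:R : R) (z%:R : R) => a b d ha hb hd ab bd.
(* With h(t) = (t - c)^2 - V, the second divided difference gives (d - b) h(a) + (b - a) h(d) - (d -
   a) h(b) = (b - a)(d - b)(d - a), whose left side is nonpositive and right side positive. *)
have pa : 0 < b - a by rewrite subr_gt0.
have pd : 0 < d - b by rewrite subr_gt0.
have := mulr_ge0_le0 (ltW pd) ha; have := mulr_ge0_le0 (ltW pa) hd.
have := mulr_gt0 (mulr_gt0 pa pd) (addr_gt0 pa pd).
have := mulr_ge0_le0 (ltW (addr_gt0 pa pd)) hb.
nra.
Qed.

(** * The weights of q and scaling of one coordinate *)

Section Q.
Variables (R : realType) (n : nat).
Implicit Types (u s : R) (r : 'rV[R]_n).

Lemma q_wvar u r : q u r = (1 + u) ^+ 2 / (n%:R * u) *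
  wvar (fun i : 'I_n.+1 => i%:R) (fun i => weight u r i).
Proof.
have E (f : 'I_n.+1 -> R) : \sum_i f i * prob u r i =
    (\sum_i f i * weight u r i) / \sum_(i < n.+1) weight u r i.
  by rewrite mulr_suml; apply: eq_bigr => i _; rewrite /prob mulrA.
by rewrite /q /mean !E.
Qed.

Lemma weight_gt0 u r i : 0 < u -> (forall j, 0 < r 0 j) -> (i <= n)%N ->
  0 < weight u r i.
Proof.
move=> u0 r0 ni; rewrite /weight !mulr_gt0 ?exprn_gt0 ?prodr_gt0//.
by rewrite ltr0n bin_gt0.
Qed.

Lemma sum_weight_gt0 u r : 0 < u -> (forall j, 0 < r 0 j) ->
  0 < \sum_(i < n.+1) weight u r i.
Proof.
move=> u0 r0; rewrite (bigD1 ord0)//= ltr_pwDl ?weight_gt0 ?sumr_ge0// => i _.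
by rewrite ltW ?weight_gt0 ?leq_ord.
Qed.

Definition scale_coord r (k : 'I_n) s : 'rV[R]_n :=
  \row_j (if j == k then (1 + s) * r 0 j else r 0 j).

(** The 0-based index [k] stands for r_(k+1), which enters a_i exactly when i >= k + 1. This is the
    tilt of [wvar_tilt] on a tail. *)
Lemma weight_scale_coord u r k s i :
  weight u (scale_coord r k s) i = (1 + s * (k < i)%N%:R) * weight u r i.
Proof.
suff prodE : \prod_(j < n | (j < i)%N) scale_coord r k s 0 j =
    (1 + s * (k < i)%N%:R) * \prod_(j < n | (j < i)%N) r 0 j.
  by rewrite /weight prodE mulrCA !mulrA.
have [ki|ik] := ltnP k i; last first.
  rewrite mulr0 addr0 mul1r; apply: eq_bigr => j ji; rewrite mxE.
  by case: eqP ji => // ->; rewrite ltnNge ik.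
rewrite mulr1 (bigD1 k ki) [in RHS](bigD1 k ki) /= mxE eqxx mulrA.
by congr (_ * _); apply: eq_bigr => j /andP[_ /negPf jk]; rewrite mxE jk.
Qed.

(** * Reversal symmetry *)

(** The inverse of the product of the last n - i ratios is the product of the first i divided by the
    full product. The resulting factor does not depend on [i], so [wvar_scale] removes it. *)
Lemma weight_revinv u r i : 0 < u -> (forall j, 0 < r 0 j) -> (i <= n)%N ->
  weight u^-1 (revinv r) (n - i) = ((\prod_j r 0 j) * u ^+ n)^-1 * weight u r i.
Proof.
move=> u0 r0 ni; rewrite /weight bin_sub//.
have nz (P : pred 'I_n) : \prod_(j | P j) r 0 j != 0.
  by rewrite gt_eqF// prodr_gt0.
have -> : \prod_(j < n | (j < n - i)%N) revinv r 0 j =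
    (\prod_(j < n | ~~ (j < i)%N) r 0 j)^-1.
  rewrite (reindex_inj rev_ord_inj) -prodfV; apply: eq_big => [j|j _] /=.
    by have := ltn_ord j; lia.
  by rewrite mxE rev_ordK.
rewrite [\prod_j r 0 j](bigID (fun j : 'I_n => (j < i)%N)) /= exprVn.
have -> : u ^+ n = u ^+ (n - i) * u ^+ i by rewrite -exprD subnK.
by field; rewrite !nz !expf_neq0 ?gt_eqF.
Qed.

Lemma q_revinv u r : 0 < u -> (forall j, 0 < r 0 j) ->
  q u r = q u^-1 (revinv r).
Proof.
move=> u0 r0; rewrite !q_wvar.
have c0 : ((\prod_j r 0 j) * u ^+ n)^-1 != 0.
  by rewrite gt_eqF// invr_gt0 mulr_gt0 ?exprn_gt0 ?prodr_gt0.
rewrite -(wvar_rev (lt0r_neq0 (sum_weight_gt0 u0 r0))).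
rewrite -[in LHS](wvar_scale _ _ c0); congr (_ * _).
  (* For n = 0 both prefactors are 0, as the inverse of 0 is 0. *)
  have [->|n0] := eqVneq n 0%N; first by rewrite !mul0r !invr0 !mulr0.
  by field; rewrite pnatr_eq0 n0 gt_eqF.
apply: eq_wvar => i; rewrite -weight_revinv//= subSS ?leq_subr//.
by rewrite subKn ?leq_ord.
Qed.

Lemma revinvK r : revinv (revinv r) = r.
Proof. by apply/rowP => j; rewrite !mxE rev_ordK invrK. Qed.

(** * The box and its edges under reversal *)

Lemma box_gt0 (Omega : R) r : 1 <= Omega -> box Omega r -> forall j, 0 < r 0 j.
Proof.
move=> O1 br j; have /andP[/(lt_le_trans _)-> //] := br j.
by rewrite invr_gt0 (lt_le_trans ltr01).
Qed.

Lemma box_revinv (Omega : R) r : 1 <= Omega -> box Omega r ->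
  box Omega (revinv r).
Proof.
move=> O1 br j; have r0 := box_gt0 O1 br (rev_ord j).
have O0 : 0 < Omega by rewrite (lt_le_trans ltr01).
have /andP[lo hi] := br (rev_ord j); rewrite mxE.
by rewrite lef_pV2 ?posrE// hi -[leRHS]invrK lef_pV2 ?posrE ?invr_gt0.
Qed.

Lemma maximizer_revinv (Omega u : R) r : 1 <= Omega -> 0 < u ->
  maximizer (q u) (box Omega) r -> maximizer (q u^-1) (box Omega) (revinv r).
Proof.
move=> O1 u0 [br rmax]; split=> [|y yb]; first exact: box_revinv.
rewrite -q_revinv//; last exact: box_gt0 br.
rewrite -(revinvK y) -q_revinv//; first exact/rmax/box_revinv.
exact/(box_gt0 O1)/box_revinv.
Qed.

Lemma edge_box (Omega : R) r (k : 'I_n) E : 1 <= Omega ->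
  edge Omega k E -> E r -> box Omega r.
Proof.
move=> O1 [c cO ->] [rk rc] j; have O0 : 0 < Omega by rewrite (lt_le_trans ltr01).
have [->//|jk] := eqVneq j k.
have VO : Omega^-1 <= Omega by rewrite (le_trans _ O1)// invf_le1.
by rewrite rc//; case: (cO j jk) => ->; rewrite lexx ?VO.
Qed.

(** The point itself serves as the vector of frozen values. *)
Lemma edge_of_endpoints (Omega : R) r (k : 'I_n) : box Omega r ->
  (forall j, j != k -> r 0 j = Omega^-1 \/ r 0 j = Omega) ->
  exists2 E, edge Omega k E & E r.
Proof. by move=> br rk; eexists; [exists r => //|split]. Qed.

Lemma edge_revinv (Omega : R) r (k : 'I_n) E : 1 <= Omega ->
  edge Omega k E -> E r -> exists2 E', edge Omega (rev_ord k) E' & E' (revinv r).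
Proof.
move=> O1 Ek Er; apply: edge_of_endpoints; first exact/box_revinv/(edge_box O1 Ek).
move=> j jk; have [c cO EE] := Ek; move: Er; rewrite EE => -[_ rc].
have rjk : rev_ord j != k by rewrite -(inj_eq rev_ord_inj) rev_ordK.
by rewrite mxE rc//; case: (cO _ rjk) => ->; rewrite ?invrK; auto.
Qed.

(** * Location of the maximizers *)

Lemma maximizer_free_coord_uniq (Omega u : R) r (k l : 'I_n) :
  1 <= Omega -> 0 < u -> maximizer (q u) (box Omega) r -> (k < l)%N ->
  Omega^-1 < r 0 k < Omega -> Omega^-1 < r 0 l < Omega -> False.
Proof.
move=> O1 u0 [br rmax] kl; have r0 := box_gt0 O1 br.
have OV0 : 0 < Omega^-1 by rewrite invr_gt0 (lt_le_trans ltr01).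
have n0 : (0 < n)%N by rewrite (leq_ltn_trans _ (ltn_ord k)).
have crit (j : 'I_n) : Omega^-1 < r 0 j < Omega ->
    dvar (fun i : 'I_n.+1 => i%:R) (fun i => weight u r i)
      [pred i : 'I_n.+1 | (j < i)%N] = 0.
  move=> /andP[lo hi].
  (* For [|s| < d] the scaled coordinate [(1 + s) * r 0 j] stays in the interval, so the scaled
     point competes with the maximizer. *)
  pose d := Num.min (1 - Omega^-1 / r 0 j) (Omega / r 0 j - 1).
  apply: (@dvar_eq0 _ _ _ _ _ d); rewrite ?sum_weight_gt0//.
    by rewrite lt_min !subr_gt0 ltr_pdivrMr// mul1r lo ltr_pdivlMr// mul1r hi.
  move=> s; rewrite ltr_norml lt_min ltrNl lt_min => /andP[/andP[slo _] /andP[_ shi]].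
  have bs : box Omega (scale_coord r j s).
    move=> i; rewrite mxE; case: eqP => [->|_]; last exact: br.
    apply/andP; split.
      by rewrite -ler_pdivrMr//; lra.
    by rewrite -ler_pdivlMr//; lra.
  have E : (fun i : 'I_n.+1 => weight u (scale_coord r j s) i) =
      (fun i => (1 + s * ([pred i : 'I_n.+1 | (j < i)%N] i)%:R) * weight u r i).
    by apply/funext => i; rewrite weight_scale_coord.
  rewrite -E; split; first exact/(sum_weight_gt0 u0)/(box_gt0 O1 bs).
  have := rmax _ bs; rewrite !q_wvar ler_pM2l// divr_gt0 ?exprn_gt0 ?addr_gt0//.
  by rewrite mulr_gt0 ?ltr0n.
move=> /crit Fk /crit Fl; move: Fl; apply/eqP.
by apply: (dvar_tail_inj _ kl _ Fk) => // i; rewrite weight_gt0 ?leq_ord.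
Qed.

Lemma maximizer_vertex_or_edge (Omega u : R) r :
  1 <= Omega -> 0 < u -> maximizer (q u) (box Omega) r ->
  vertex Omega r \/ exists (k : 'I_n) E, edge Omega k E /\ E r.
Proof.
move=> O1 u0 rmax; have br := rmax.1.
have endpoint j : ~ (Omega^-1 < r 0 j < Omega) ->
    r 0 j = Omega^-1 \/ r 0 j = Omega.
  have /andP[] := br j; rewrite !le_eqVlt.
  by move=> /predU1P[->|lo] /predU1P[->|hi]; auto; rewrite lo hi.
have [[k kfree]|/forallNP nofree] :=
  pselect (exists k, Omega^-1 < r 0 k < Omega); last first.
  by left => j; exact/endpoint/nofree.
right; have [|E Ek Er] := edge_of_endpoints (k := k) br; last by exists k, E.
move=> j jk; apply: endpoint => jfree.
have [kj|jk'|/val_inj/eqP] := ltngtP k j; last by rewrite eq_sym (negPf jk).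
  exact: (maximizer_free_coord_uniq O1 u0 rmax kj kfree jfree).
exact: (maximizer_free_coord_uniq O1 u0 rmax jk' jfree kfree).
Qed.

Lemma maximizer_half_edge (Omega u : R) r :
  (0 < n)%N -> 1 <= Omega -> 0 < u -> maximizer (q u) (box Omega) r ->
  (exists (k : 'I_n) E, [/\ (k.+1 <= uphalf n)%N, edge Omega k E & E r]) \/
  (exists (k : 'I_n) E, [/\ (k.+1 <= uphalf n)%N, edge Omega k E & E (revinv r)]).
Proof.
move=> n0 O1 u0 rmax.
have [rO|[k [E [Ek Er]]]] := maximizer_vertex_or_edge O1 u0 rmax.
  (* A vertex lies on the edge through it whose free coordinate is r_1. *)
  have [|E Ek Er] := edge_of_endpoints (k := Ordinal n0) rmax.1; first by move=> j _.
  by left; exists (Ordinal n0), E; split => //=; rewrite uphalf_gt0.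
have [kn|nk] := leqP k.+1 (uphalf n); first by left; exists k, E.
(* Reversal turns the 1-based index k + 1 > ceil(n/2) into n - k, which is at most ceil(n/2). *)
right; have [E' Ek' Er'] := edge_revinv O1 Ek Er.
by exists (rev_ord k), E'; split => //=; have := ltn_ord k; lia.
Qed.

(** * Existence of a maximizer by continuity and compactness *)

(** The only denominator that varies with [r] is the total weight, which is positive on the box. *)
Lemma q_continuous_within (Omega u : R) : 1 <= Omega -> 0 < u ->
  {within box Omega, continuous (q u : 'rV[R]_n -> R)}.
Proof.
move=> O1 u0; apply: continuous_in_subspaceT => r /set_mem br.
have r0 := box_gt0 O1 br.
have sumc (f : 'I_n.+1 -> 'rV[R]_n -> R) : (forall i, f i x @[x --> r] --> f i r) ->
    \sum_i f i x @[x --> r] --> \sum_i f i r.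
  move=> fc; apply: (cvg_big (@add_continuous R) (nbhs_filter r)) => i _.
  exact: fc.
have wc i : weight u x i @[x --> r] --> weight u r i.
  apply: (@cvgMr_tmp _ _ _ (nbhs_filter r)).
  apply: (@cvgMl_tmp _ _ _ (nbhs_filter r)).
  apply: (cvg_big (@mul_continuous R) (nbhs_filter r)) => j _.
  exact: coord_continuous.
have pc i : prob u x i @[x --> r] --> prob u r i.
  apply: (@cvgM _ _ _ (nbhs_filter r) (fun x => weight u x i)); first exact: wc.
  apply: (@cvgV _ _ _ (nbhs_filter r) (fun x => \sum_(j < n.+1) weight u x j)).
    by rewrite gt_eqF// sum_weight_gt0.
  exact: sumc.
have mc : mean u x @[x --> r] --> mean u r.
  apply: sumc => i; apply: (@cvgMl_tmp _ _ _ (nbhs_filter r)); exact: pc.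
apply: (@cvgMl_tmp _ _ _ (nbhs_filter r)); apply: sumc => i.
apply: (@cvgM _ _ _ (nbhs_filter r) (fun x => (i%:R - mean u x) ^+ 2));
  last exact: pc.
have dc : i%:R - mean u x @[x --> r] --> i%:R - mean u r.
  exact: (@cvgB R R^o _ _ (nbhs_filter r) (fun=> i%:R) _ _ _ (cvg_cst _) mc).
exact: (@cvgM _ _ _ (nbhs_filter r) _ _ _ _ dc dc).
Qed.

Lemma maximizer_exists (Omega u : R) : 1 <= Omega -> 0 < u ->
  exists r, maximizer (q u) (box Omega : set 'rV[R]_n) r.
Proof.
move=> O1 u0.
have O0 : 0 < Omega by rewrite (lt_le_trans ltr01).
have box0 : (box Omega : set 'rV[R]_n) !=set0.
  by exists (const_mx 1) => j; rewrite mxE O1 andbT invf_le1.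
have boxc : compact (box Omega : set 'rV[R]_n).
  have -> : box Omega =
      [set v : 'rV[R]_n | forall i, `[Omega^-1, Omega]%classic (v ord0 i)].
    by apply/seteqP; split => v bv i; have := bv i; rewrite /= in_itv.
  apply: (@rV_compact _ _ (fun=> `[Omega^-1, Omega]%classic)) => i.
  exact: segment_compact.
have [r br rmax] := compact_EVT_max box0 boxc (q_continuous_within O1 u0).
by exists r; split=> [|y yb]; [exact: set_mem|exact/rmax/mem_set].
Qed.

End Q.

(* With 0-based ordinals, "k.+1 <= uphalf n" says that the free coordinate is
   one of r_1, ..., r_(ceil (n/2)). *)
Theorem theorem2 (R : realType) (n : nat) (Omega u : R)
    (hn : (1 <= n)%N) (hOmega : 1 <= Omega) (hu : 0 < u) :
  [/\ (* maximizers lie at vertices or on edges *)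
      forall r : 'rV[R]_n, maximizer (q u) (box Omega) r ->
        vertex Omega r \/
        exists (k : 'I_n) (E : set 'rV[R]_n), edge Omega k E /\ E r,
      (* reversal symmetry *)
      forall (v : R) (r : 'rV[R]_n), 0 < v -> (forall j, 0 < r 0 j) ->
        q v r = q v^-1 (revinv r),
      (* edges k <= ceil (n/2) suffice to find the maximizers, *)
      forall r : 'rV[R]_n, maximizer (q u) (box Omega) r ->
        (exists (k : 'I_n) (E : set 'rV[R]_n),
           [/\ (k.+1 <= uphalf n)%N, edge Omega k E & E r]) \/
        (maximizer (q u^-1) (box Omega) (revinv r) /\
         exists (k : 'I_n) (E : set 'rV[R]_n),
           [/\ (k.+1 <= uphalf n)%N, edge Omega k E & E (revinv r)])
    & (* and to bound q on the whole box *)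
      forall M : R,
        (forall r : 'rV[R]_n, box Omega r -> q u r <= M) <->
        (forall (k : 'I_n) (E : set 'rV[R]_n) (r : 'rV[R]_n),
           (k.+1 <= uphalf n)%N -> edge Omega k E -> E r ->
           q u r <= M /\ q u^-1 r <= M)].
Proof.
split.
- by move=> r; exact: maximizer_vertex_or_edge.
- by move=> v r; exact: q_revinv.
- move=> r rmax; have [?|?] := maximizer_half_edge hn hOmega hu rmax; first by left.
  by right; split=> //; exact: maximizer_revinv.
move=> M; split=> [qM k E r _ Ek Er|qM r br].
  have br := edge_box hOmega Ek Er; split; first exact: qM.
  have br' := box_revinv hOmega br.
  (* The value at [u^-1] and [r] is the value at [u] and [revinv r], again a point of the box. *)
  rewrite -(revinvK r) -q_revinv//; first exact: qM.
  exact: box_gt0 br'.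
(* It suffices to bound q at one maximizer: either it lies on an admissible edge, or its reversal
   does and the bound at [u^-1] applies. *)
have [r' rmax] := maximizer_exists n hOmega hu.
apply: le_trans (rmax.2 _ br) _.
have [[k [E [kn Ek Er]]]|[k [E [kn Ek Er]]]] := maximizer_half_edge hn hOmega hu rmax.
  by have [] := qM k E r' kn Ek Er.
rewrite q_revinv//; last exact: box_gt0 rmax.1.
by have [] := qM k E _ kn Ek Er.
Qed.
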